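(* Let $\Omega\subseteq\mathbb{R}^n$ be closed and convex, let $H:\mathbb{R}^n\to\mathbb{R}^n$ be continuous on $\mathbb{R}^n$ and pseudomonotone on $\Omega$, and assume $\mathrm{SOL}(\Omega,H)\neq\emptyset$. Let $\{x_k\}_{k\ge 0}$ be the sequence generated by the EG-Anderson(1) algorithm, and assume that the algorithm does not stop after finitely many iterations. Then the sequence $\{x_k\}$ converges to a solution of $\mathrm{VI}(\Omega,H)$, i.e. to a point of $\mathrm{SOL}(\Omega,H)$.
   Context: Notation. $\|\cdot\|$ is the Euclidean norm on $\mathbb{R}^n$ and $P_\Omega$ is the Euclidean projection onto $\Omega$. The variational inequality problem $\mathrm{VI}(\Omega,H)$ is to find $x^*\in\Omega$ with $\langle H(x^* ),x-x^*\rangle\ge 0$ for all $x\in\Omega$; its solution set is $\mathrm{SOL}(\Omega,H)$. $H$ is pseudomonotone on $\Omega$ if for all $x,y\in\Omega$, $\langle H(x),y-x\rangle\ge 0$ implies $\langle H(y),y-x\rangle\ge 0$. For $t>0$ and $x\in\mathbb{R}^n$ put $G_t(x)=P_\Omega(x-tH(x))$, $\tilde G_t(x)=P_\Omega(x-tH(G_t(x)))$, $F_t(x)=G_t(x)-x$, $\tilde F_t(x)=\tilde G_t(x)-x$. EG-Anderson(1) algorithm. Parameters: $\omega\ge 0$, $\gamma>0$, $\tau>\frac12$, $\rho,\mu\in(0,1)$, and a (sufficiently large) constant $M>0$. Choose $x_0\in\Omega$ and set $\sigma_0=1$. For $k=0,1,2,\ldots$ do: Step 1. If $F_\gamma(x_k)=\mathbf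 0$, stop. Otherwise set $t_k=\gamma$ and go to Step 2. Step 2 (line search). Compute $y_{k+0.5}=P_\Omega(x_k-t_kH(x_k))$ and $y_{k+1}=P_\Omega(x_k-t_kH(y_{k+0.5}))$. If $$t_k\langle H(y_{k+0.5})-H(x_k),\,y_{k+0.5}-y_{k+1}\rangle\le\frac{\mu}{2}\left(\|x_k-y_{k+0.5}\|^2+\|y_{k+0.5}-y_{k+1}\|^2\right),$$ go to Step 3. Otherwise replace $t_k$ by $\rho t_k$ and repeat Step 2. (Thus, for the final $t_k$, $y_{k+0.5}=G_{t_k}(x_k)$ and $y_{k+1}=\tilde G_{t_k}(x_k)$.) Step 3. Compute $F_{t_k}(x_k)=y_{k+0.5}-x_k$ and $\tilde F_{t_k}(x_k)=y_{k+1}-x_k$. If $\|\tilde F_{t_k}(x_k)\|<\min\{\|F_{t_k}(x_k)\|,\ \omega\sigma_k^{-\tau}\}$, set $$\alpha_k=\frac{\langle\tilde F_{t_k}(x_k),\,\tilde F_{t_k}(x_k)-F_{t_k}(x_k)\rangle}{\|\tilde F_{t_k}(x_k)-F_{t_k}(x_k)\|^2};$$ otherwise set $\alpha_k=M+1$. Step 4. If $|\alpha_k|\le M$, set $x_{k+1}=\alpha_kx_k+(1-\alpha_k)y_{k+1}$ and $\sigma_{k+1}=\sigma_k+1$. Otherwise set $x_{k+1}=y_{k+1}$ and $\sigma_{k+1}=\sigma_k$. *)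

(* Defs.v *)
From HB Require Import structures.
From mathcomp Require Export all_boot all_order all_algebra.
From mathcomp Require Export all_classical all_reals all_analysis.
Export Order.TTheory GRing.Theory Num.Theory.
Export numFieldNormedType.Exports.

Set Implicit Arguments.
Unset Strict Implicit.
Unset Printing Implicit Defensive.

Local Open Scope classical_set_scope.
Local Open Scope ring_scope.

Definition dot (R : realType) (n : nat) (u v : 'rV[R]_n) : R :=
  \sum_(i < n) u 0 i * v 0 i.

(* The library norm `|u| on 'rV[R]_n is the sup norm; it induces the same
   topology as enorm, so closed sets, continuity and limits are the
   library's. *)
Definition enorm (R : realType) (n : nat) (u : 'rV[R]_n) : R :=
  Num.sqrt (dot u u).

(* The default value x of xget only matters when no nearest point exists,
   which cannot happen for Omega nonempty, closed and convex. *)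
Definition proj (R : realType) (n : nat) (Omega : set 'rV[R]_n)
    (x : 'rV[R]_n) : 'rV[R]_n :=
  xget x [set p | Omega p /\
                  forall z, Omega z -> enorm (x - p) <= enorm (x - z)].

Definition SOL (R : realType) (n : nat) (Omega : set 'rV[R]_n)
    (H : 'rV[R]_n -> 'rV[R]_n) : set 'rV[R]_n :=
  [set xs | Omega xs /\ forall x, Omega x -> 0 <= dot (H xs) (x - xs)].

Definition pseudomonotone (R : realType) (n : nat) (Omega : set 'rV[R]_n)
    (H : 'rV[R]_n -> 'rV[R]_n) : Prop :=
  forall x y, Omega x -> Omega y ->
    0 <= dot (H x) (y - x) -> 0 <= dot (H y) (y - x).

Section EGAnderson.
Context (R : realType) (n : nat).
Context (Omega : set 'rV[R]_n) (H : 'rV[R]_n -> 'rV[R]_n).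
Context (omega gamma tau rho mu M : R).
Implicit Types (x : 'rV[R]_n) (t : R) (sigma : nat).

Definition mapG t x := proj Omega (x - t *: H x).
Definition mapGt t x := proj Omega (x - t *: H (mapG t x)).
Definition mapF t x := mapG t x - x.
Definition mapFt t x := mapGt t x - x.

Definition ls_accept x t : bool :=
  let y05 := mapG t x in
  let y1 := mapGt t x in
  t * dot (H y05 - H x) (y05 - y1)
    <= mu / 2 * (enorm (x - y05) ^+ 2 + enorm (y05 - y1) ^+ 2).

(* The line search returns gamma * rho ^+ m for the first accepted trial m.
   The default 0 of xget only matters if the search does not terminate,
   which cannot happen for H continuous and mapF gamma x != 0. *)
Definition ls_step x : R :=
  gamma * rho ^+ xget 0%N
    [set m | ls_accept x (gamma * rho ^+ m) /\
             forall j, (j < m)%N -> ~~ ls_accept x (gamma * rho ^+ j)].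

Definition ega_alpha x sigma : R :=
  let F := mapF (ls_step x) x in
  let Ft := mapFt (ls_step x) x in
  if enorm Ft < Num.min (enorm F) (omega * sigma%:R `^ (- tau))
  then dot Ft (Ft - F) / enorm (Ft - F) ^+ 2
  else M + 1.

Definition ega_step (s : 'rV[R]_n * nat) : 'rV[R]_n * nat :=
  let (x, sigma) := s in
  let y1 := mapGt (ls_step x) x in
  let a := ega_alpha x sigma in
  if `|a| <= M then (a *: x + (1 - a) *: y1, sigma.+1) else (y1, sigma).

(* The k-th iterate x_k, from (x_0, sigma_0) = (x0, 1).  The stopping test of
   Step 1 is not built in: the iteration does not stop iff
   mapF gamma (ega_seq x0 k) != 0 for every k. *)
Definition ega_seq x0 (k : nat) : 'rV[R]_n := (iter k ega_step (x0, 1%N)).1.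

End EGAnderson.

(* Main.v *)
Require Import Defs.
From mathcomp Require Import ring lra.

(** For a solution xs, the extragradient step satisfies Korpelevich's inequality
    |y_{k+1} - xs|^2 <= |x_k - xs|^2 - (1 - mu) (|x_k - y_{k+.5}|^2 + ...), for
    which x_k need not lie in Omega.  An Anderson step extrapolates with some
    alpha_k <= 1/2 and |alpha_k| <= M; it keeps half of that decrease, up to an
    error of at most M (1 + M) omega^2 sigma_k^(-2 tau).  As 2 tau > 1, this error
    is at most a difference of a bounded potential of sigma_k, so |x_k - xs|
    converges for every solution xs and |x_k - y_{k+.5}| tends to 0.

    Near a point that is not a solution, |x - G_t(x)| >= c t for all t <= gamma,
    and continuity of H makes the line search accept all small t, uniformly.
    Hence t_k and the residual |x_k - y_{k+.5}| are bounded away from 0 near such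
    a point, which therefore is not a cluster point of (x_k).  So some cluster
    point is a solution xb, and |x_k - xb|, which converges, tends to 0. *)

Set Implicit Arguments.
Unset Strict Implicit.
Unset Printing Implicit Defensive.

Local Open Scope classical_set_scope.
Local Open Scope ring_scope.

(** * Euclidean norm *)

Section Euclidean.
Context (R : realType) (n : nat).
Implicit Types (u v w x y : 'rV[R]_n) (a : R).

Lemma dotC u v : dot u v = dot v u.
Proof. by apply: eq_bigr => i _; rewrite mulrC. Qed.

Lemma dotDl u v w : dot (u + v) w = dot u w + dot v w.
Proof. by rewrite -big_split; apply: eq_bigr => i _; rewrite mxE mulrDl. Qed.

Lemma dotZl a u v : dot (a *: u) v = a * dot u v.
Proof. by rewrite mulr_sumr; apply: eq_bigr => i _; rewrite mxE mulrA. Qed.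

Lemma dotNl u v : dot (- u) v = - dot u v.
Proof. by rewrite -scaleN1r dotZl mulN1r. Qed.

Lemma dotDr u v w : dot w (u + v) = dot w u + dot w v.
Proof. by rewrite !(dotC w) dotDl. Qed.

Lemma dotZr a u v : dot v (a *: u) = a * dot v u.
Proof. by rewrite !(dotC v) dotZl. Qed.

Lemma dotNr u v : dot v (- u) = - dot v u.
Proof. by rewrite !(dotC v) dotNl. Qed.

Definition dotE := (dotDl, dotDr, dotNl, dotNr, dotZl, dotZr).

Lemma dot_ge0 u : 0 <= dot u u.
Proof. by apply: sumr_ge0 => i _; rewrite -expr2 sqr_ge0. Qed.

Lemma enorm_ge0 u : 0 <= enorm u.
Proof. exact: sqrtr_ge0. Qed.

Lemma enorm0 : enorm (0 : 'rV[R]_n) = 0.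
Proof. by rewrite /enorm -(scale0r 0) dotZl mul0r sqrtr0. Qed.

Lemma sqr_enorm u : enorm u ^+ 2 = dot u u.
Proof. by rewrite sqr_sqrtr ?dot_ge0. Qed.

Lemma enorm_eq0 u : enorm u = 0 -> u = 0.
Proof.
move=> u0; have : dot u u = 0 by rewrite -sqr_enorm u0 expr0n.
move/psumr_eq0P => d0; apply/rowP => i; rewrite mxE; apply/eqP.
by rewrite -[_ == _]orbb -mulf_eq0 d0// => j _; rewrite -expr2 sqr_ge0.
Qed.

Lemma enormN u : enorm (- u) = enorm u.
Proof. by rewrite /enorm !dotE opprK. Qed.

Lemma enormB u v : enorm (u - v) = enorm (v - u).
Proof. by rewrite -enormN opprB. Qed.

Lemma enormZ a u : enorm (a *: u) = `|a| * enorm u.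
Proof.
by rewrite /enorm !dotE mulrA -expr2 sqrtrM ?sqr_ge0// sqrtr_sqr.
Qed.

Lemma dot_le u v : dot u v <= enorm u * enorm v.
Proof.
have [v0|] := eqVneq (enorm v) 0.
  by rewrite (enorm_eq0 v0) -(scale0r u) dotZr mul0r mulr_ge0 ?enorm_ge0.
rewrite neq_lt ltNge enorm_ge0/= => v_gt0.
have [|/ltW] := leP (dot u v) 0.
  by move=> /le_trans; apply; rewrite mulr_ge0 ?enorm_ge0.
move=> uv0; rewrite -(@ler_pXn2r _ 2)// ?nnegrE// ?mulr_ge0 ?enorm_ge0//.
(* This squared norm is |v|^2 times the Cauchy-Schwarz gap |u|^2 |v|^2 - <u, v>^2. *)
have := dot_ge0 (dot v v *: u - dot u v *: v).
rewrite !dotE (dotC v u) exprMn !sqr_enorm.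
have vv : 0 < dot v v by rewrite -sqr_enorm exprn_gt0.
move=> H; rewrite -subr_ge0 -(pmulr_rge0 _ vv); lra.
Qed.

Lemma enormD u v : enorm (u + v) <= enorm u + enorm v.
Proof.
rewrite -(@ler_pXn2r _ 2)// ?nnegrE ?addr_ge0 ?enorm_ge0//.
rewrite sqrrD !sqr_enorm !dotE (dotC v u).
by have := dot_le u v; lra.
Qed.

Lemma enorm_triangle v u w : enorm (u - w) <= enorm (u - v) + enorm (v - w).
Proof. by rewrite -[u - w](subrKA v) enormD. Qed.

Lemma norm_le_enorm u : `|u| <= enorm u.
Proof.
rewrite [`|u|]mx_normrE; apply: bigmax_le => [|[i j] _] /=; first exact: enorm_ge0.
rewrite ord1 -sqrtr_sqr ler_sqrt ?dot_ge0// /dot (bigD1 j)//= -expr2 lerDl.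
by apply: sumr_ge0 => k _; rewrite -expr2 sqr_ge0.
Qed.

Lemma near_lt (T : topologicalType) (f : T -> R) (t : T) (a : R) :
  {for t, continuous f} -> f t < a -> \forall s \near t, f s < a.
Proof. by move=> cf; exact: (cvgr_lt _ cf). Qed.

Lemma continuous_dot (T : topologicalType) (f g : T -> 'rV[R]_n) (t : T) :
  {for t, continuous f} -> {for t, continuous g} ->
  {for t, continuous (fun z => dot (f z) (g z))}.
Proof.
move=> cf cg; rewrite /prop_for /continuous_at /dot.
apply: cvg_big => [|i _]; first exact: add_continuous.
have cc (h : T -> 'rV[R]_n) : {for t, continuous h} -> h z 0 i @[z --> t] --> h t 0 i.
  move=> ch; apply: (@continuous_comp _ _ _ h (fun M : 'rV[R]_n => M 0 i)) => //.
  exact: coord_continuous.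
by apply: cvgM; exact: cc.
Qed.

Lemma continuous_enorm : continuous (@enorm R n).
Proof.
move=> x; apply: (@continuous_comp _ _ _ (fun x => dot x x)).
  by apply: continuous_dot; exact: cvg_id.
exact: sqrt_continuous.
Qed.

(** Passes between the sup-norm topology and Euclidean balls. The sup norm is at most [enorm];
    conversely, continuity of [enorm] at 0 replaces an explicit equivalence constant. *)
Lemma near_enorm x (P : set 'rV[R]_n) :
  (\forall y \near x, P y) <->
  exists2 d : R, 0 < d & forall y, enorm (y - x) < d -> P y.
Proof.
split=> [/nbhs_ballP[d /= d0 dP]|[d d0 dP]].
  exists d => // y yd; apply: dP; rewrite -ball_normE/= distrC.
  exact: le_lt_trans (norm_le_enorm _) yd.
have : {for x, continuous (fun y => enorm (y - x))}.
  apply: (@continuous_comp _ _ _ (fun y => y - x)).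
    by apply: continuousB; [exact: cvg_id|exact: cst_continuous].
  exact: continuous_enorm.
rewrite /prop_for/continuous_at subrr enorm0.
move=> /cvgrPdist_lt/(_ _ d0); apply: filterS => y.
by rewrite sub0r normrN ger0_norm ?enorm_ge0// => /dP.
Qed.

Lemma compact_enorm_ball x (r : R) : compact [set z | enorm (x - z) <= r].
Proof.
apply: bounded_closed_compact.
  exists (`|x| + r); split => [|s rs z /= xz]; first exact: num_real.
  apply/ltW/(le_lt_trans _ rs); rewrite -[z](subKr x).
  by rewrite (le_trans (ler_normB _ _))// lerD2l (le_trans (norm_le_enorm _)).
have cf : continuous (fun z : 'rV[R]_n => enorm (x - z)).
  move=> z; apply: (@continuous_comp _ _ _ (fun z : 'rV[R]_n => x - z)).
    by apply: continuousB; [exact: cst_continuous|exact: cvg_id].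
  exact: continuous_enorm.
by apply: (@preimage_closed _ _ _ [set t | t <= r]) => //; exact: closed_le.
Qed.

End Euclidean.

(** * Projection onto a closed convex set *)

Section Projection.
Context (R : realType) (n : nat) (Omega : set 'rV[R]_n).
Context (Oclosed : closed Omega)
  (Oconvex : convex_set (Omega : set (convex_lmodType 'rV[R]_n)))
  (Oneq0 : Omega !=set0).
Implicit Types x y z : 'rV[R]_n.

Lemma convex_segment y z (l : R) : Omega y -> Omega z -> 0 <= l <= 1 ->
  Omega (y + l *: (z - y)).
Proof.
move=> Oy Oz /andP[l0 l1].
have -> : y + l *: (z - y) = l *: z + (1 - l) *: y.
  by rewrite scalerBl scale1r scalerBr addrCA.
exact: set_mem (Oconvex (Itv01 l0 l1) (mem_set Oz) (mem_set Oy)).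
Qed.

Lemma ex_nearest x :
  exists2 p, Omega p & forall z, Omega z -> enorm (x - p) <= enorm (x - z).
Proof.
have [z0 Oz0] := Oneq0.
have cf : continuous (fun z => enorm (x - z)).
  move=> z; apply: (@continuous_comp _ _ _ (fun z => x - z)).
    by apply: continuousB; [exact: cst_continuous|exact: cvg_id].
  exact: continuous_enorm.
(* Cutting by the ball through [z0] gives compactness; points of Omega outside it are farther from x
   than [z0]. *)
pose A := Omega `&` [set z | enorm (x - z) <= enorm (x - z0)].
have cA : compact A.
  by rewrite /A setIC; apply: compact_closedI => //; exact: compact_enorm_ball.
have [||p /set_mem[Op pz0] pmin] :=
  @compact_EVT_min _ R (fun z => enorm (x - z)) A _ cA.
- by exists z0; split => /=.
- exact: continuous_subspaceT.
exists p => // z Oz.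
have [xz|/ltW xz] := leP (enorm (x - z)) (enorm (x - z0)).
  by apply: pmin; rewrite inE.
exact: le_trans pz0 xz.
Qed.

Lemma proj_nearest x : Omega (proj Omega x) /\
  forall z, Omega z -> enorm (x - proj Omega x) <= enorm (x - z).
Proof.
rewrite /proj; case: xgetP => [_ ->//|nex].
by have [p Op pmin] := ex_nearest x; case: (nex p).
Qed.

Lemma proj_in x : Omega (proj Omega x).
Proof. by case: (proj_nearest x). Qed.

(** Moving from the projection towards z stays in Omega and cannot shorten the distance to x; this
    is the first-order condition. *)
Lemma proj_obtuse x z : Omega z ->
  dot (x - proj Omega x) (z - proj Omega x) <= 0.
Proof.
move=> Oz; have [Op pmin] := proj_nearest x; set p := proj Omega x in Op pmin *.
have [//|d0] := leP (dot (x - p) (z - p)) 0.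
have H (l : R) : 0 <= l <= 1 ->
    2 * l * dot (x - p) (z - p) <= l ^+ 2 * dot (z - p) (z - p).
  move=> l01; have := pmin _ (convex_segment Op Oz l01).
  rewrite -(@ler_pXn2r _ 2)// ?nnegrE ?enorm_ge0// !sqr_enorm.
  rewrite opprD addrA; move: (x - p) (z - p) => u v.
  by rewrite !dotE (dotC v u); lra.
move: d0 H; set d := dot _ _; set e := dot _ _ => d0 H.
have e0 : 0 <= e by exact: dot_ge0.
(* This l lies in (0, 1] and l e = d - l d < d, against 2 d <= l e; the denominator d + e also
   covers e = 0. *)
pose l := d / (d + e).
have de : 0 < d + e by lra.
have l0 : 0 < l by rewrite divr_gt0.
have lde : l * (d + e) = d by rewrite /l divfK// gt_eqF.
have l1 : l <= 1 by rewrite /l ler_pdivrMr//; lra.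
have ld0 : 0 < l * d by rewrite mulr_gt0.
have : 2 * d <= l * e.
  by rewrite -(ler_pM2l l0); have := H l; rewrite l1 ltW// => /(_ isT); lra.
have -> : l * e = d - l * d by move: lde; rewrite mulrDr; lra.
lra.
Qed.

Lemma proj_unique x p : Omega p ->
  (forall z, Omega z -> dot (x - p) (z - p) <= 0) -> proj Omega x = p.
Proof.
move=> Op pP; apply/eqP; rewrite -subr_eq0; apply/eqP/enorm_eq0/eqP.
rewrite -(@sqrf_eq0 R) sqr_enorm eq_le dot_ge0 andbT.
have := pP _ (proj_in x); have := proj_obtuse x Op.
move: (proj _ _) => q; rewrite !dotE ?(dotC q p) ?(dotC q x) ?(dotC p x); lra.
Qed.

Lemma proj_id p : Omega p -> proj Omega p = p.
Proof.
by move=> Op; apply: proj_unique => // z _; rewrite subrr -(scale0r 0) dotZl mul0r.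
Qed.

Lemma proj_nonexpansive x y : enorm (proj Omega x - proj Omega y) <= enorm (x - y).
Proof.
have := proj_obtuse x (proj_in y); have := proj_obtuse y (proj_in x).
move: (proj _ _) (proj _ _) => p q H1 H2.
(* Firm nonexpansiveness, the sum of the two obtuse-angle inequalities. *)
have H : dot (p - q) (p - q) <= dot (x - y) (p - q).
  move: H1 H2; rewrite !dotE ?(dotC q p) ?(dotC q x) ?(dotC p x).
  by rewrite ?(dotC p y) ?(dotC q y); lra.
have := dot_le (x - y) (p - q); move/(le_trans H).
rewrite -sqr_enorm expr2.
have := enorm_ge0 (p - q); rewrite le_eqVlt => /predU1P[<- _|p0].
  exact: enorm_ge0.
by rewrite ler_pM2r.
Qed.

End Projection.

(** * Extragradient map and line search *)

Section Extragradient.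
Context (R : realType) (n : nat) (Omega : set 'rV[R]_n) (H : 'rV[R]_n -> 'rV[R]_n).
Context (Oclosed : closed Omega)
  (Oconvex : convex_set (Omega : set (convex_lmodType 'rV[R]_n)))
  (Hcont : continuous H) (Oneq0 : Omega !=set0).
Implicit Types x y z : 'rV[R]_n.

Let P := proj_obtuse Oclosed Oconvex Oneq0.
Let Pin := proj_in Oclosed Oneq0.

Lemma continuous_enorm_comp (f : 'rV[R]_n -> 'rV[R]_n) :
  continuous f -> continuous (fun y => enorm (f y)).
Proof.
by move=> cf x; apply: (@continuous_comp _ _ _ f); [exact: cf|exact: continuous_enorm].
Qed.

(** The variational inequality at x is the obtuse-angle condition for x to be the projection of x -
    t H(x). Hence iterates that do not stop the algorithm are not solutions. *)
Lemma mapF_SOL t x : 0 < t -> SOL Omega H x -> mapF Omega H t x = 0.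
Proof.
move=> t0 [Ox xS]; apply/eqP; rewrite subr_eq0; apply/eqP.
apply: (proj_unique Oclosed Oconvex Oneq0) => // z Oz.
by rewrite addrAC subrr add0r dotNl dotZl oppr_le0 mulr_ge0 ?xS// ltW.
Qed.

(** Extrapolated iterates may leave Omega, so cluster points outside Omega must be excluded too. *)
Lemma near_dist xb : ~ Omega xb ->
  exists2 c : R, 0 < c &
    \forall x \near xb, forall z, Omega z -> c <= enorm (x - z).
Proof.
move=> nO; have : \forall x \near xb, ~ Omega x.
  by apply: open_nbhs_nbhs; split => //; exact: closed_openC.
move=> /near_enorm[d d0 dO]; exists (d / 2); first by rewrite divr_gt0.
apply/near_enorm; exists (d / 2) => [|x xd z Oz]; first by rewrite divr_gt0.
rewrite leNgt; apply/negP => xz; apply: (dO z) => //.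
by have := enorm_triangle x z xb; rewrite (enormB z x); lra.
Qed.

Lemma near_residual_ge xb (gamma : R) : 0 < gamma -> ~ SOL Omega H xb ->
  exists2 c : R, 0 < c & \forall x \near xb, forall t, 0 < t <= gamma ->
    c * t <= enorm (x - mapG Omega H t x).
Proof.
move=> g0 nS; have [Ox|nOx] := pselect (Omega xb); last first.
  have [c c0 cP] := near_dist nOx; exists (c / gamma); first by rewrite divr_gt0.
  apply: filterS cP => x cP t /andP[t0 tg].
  apply: le_trans (cP _ (Pin _)).
  by rewrite mulrAC ler_pdivrMr// ler_pM2l.
have /existsNP[z /not_implyP[Oz /negP]] :
    ~ forall z, Omega z -> 0 <= dot (H xb) (z - xb) by move=> zP; exact: nS.
rewrite -ltNge => Hz.
pose eta := - dot (H xb) (z - xb).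
have eta0 : 0 < eta by rewrite oppr_gt0.
have cz : continuous (fun x => z - x).
  by move=> x; apply: continuousB; [exact: cst_continuous|exact: cvg_id].
pose h := enorm (H xb) + 1; pose e := enorm (z - xb) + 1.
have h0 : 0 < h by rewrite ltr_wpDl ?enorm_ge0.
have e0 : 0 < e by rewrite ltr_wpDl ?enorm_ge0.
have K0 : 0 < gamma * h + e by rewrite addr_gt0// mulr_gt0.
(* With d = x - G_t(x), the obtuse-angle inequality tested with z yields t eta / 2 <= |d| (|z - x| +
   gamma |H(x)|), and the bracket is below gamma h + e near xb. *)
exists (eta / 2 / (gamma * h + e)); first by rewrite !divr_gt0.
have n1 : \forall x \near xb, dot (H x) (z - x) < - eta / 2.
  apply: (@near_lt _ _ (fun x => dot (H x) (z - x))); last by rewrite /eta; lra.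
  by apply: (@continuous_dot _ _ _ H (fun x => z - x) xb); [exact: Hcont|exact: cz].
have n2 : \forall x \near xb, enorm (H x) < h.
  apply: (@near_lt _ _ (fun x => enorm (H x))); last by rewrite ltrDl.
  exact: continuous_enorm_comp.
have n3 : \forall x \near xb, enorm (z - x) < e.
  apply: (@near_lt _ _ (fun x => enorm (z - x))); last by rewrite ltrDl.
  exact: continuous_enorm_comp.
near=> x => t /andP[t0 tg].
rewrite mulrAC ler_pdivrMr//.
have H1 : dot (H x) (z - x) < - eta / 2 by near: x.
have H2 : enorm (H x) < h by near: x.
have H3 : enorm (z - x) < e by near: x.
have := P (x - t *: H x) Oz; rewrite -/(mapG Omega H t x).
set y := mapG _ _ _ _.
have -> : x - t *: H x - y = (x - y) - t *: H x by rewrite addrAC.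
have -> : z - y = (z - x) + (x - y) by rewrite subrKA.
have := dot_le (H x) (x - y); have := dot_le (- (x - y)) (z - x).
rewrite enormN.
move: (x - y) (z - x) H1 H2 H3 => d w H1 H2 H3.
rewrite !dotE => D1 D2 D3.
have dd := dot_ge0 d; have r0 := enorm_ge0 d.
have A1 : enorm d * enorm w <= enorm d * e by rewrite ler_wpM2l// ltW.
have A2 : t * dot (H x) d <= gamma * h * enorm d.
  apply: (@le_trans _ _ (t * (h * enorm d))).
    by rewrite ler_pM2l// (le_trans D2)// ler_wpM2r// ltW.
  by rewrite -mulrA ler_wpM2r// mulr_ge0// ltW.
have A3 : t * (eta / 2) <= - (t * dot (H x) w).
  by rewrite -mulrN ler_pM2l//; lra.
lra.
Unshelve. all: by end_near. Qed.

Lemma mapGt_dist t x : 0 < t ->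
  enorm (mapG Omega H t x - mapGt Omega H t x)
    <= t * enorm (H (mapG Omega H t x) - H x).
Proof.
move=> t0; apply: (le_trans (proj_nonexpansive Oclosed Oconvex Oneq0 _ _)).
by rewrite opprB addrC addrA subrK -scalerBr enormZ gtr0_norm.
Qed.

(** Frees the test from its second projection. Cauchy-Schwarz and [mapGt_dist] bound the left side
    by (t |H(y) - H(x)|)^2 with y = G_t(x), and the term mu / 2 |x - y|^2 alone dominates this
    square. *)
Lemma ls_acceptS (mu t : R) x : 0 < t -> 0 < mu ->
  t * enorm (H (mapG Omega H t x) - H x)
    <= Num.sqrt (mu / 2) * enorm (x - mapG Omega H t x) ->
  ls_accept Omega H mu x t.
Proof.
move=> t0 mu0 tq; rewrite /ls_accept.
have := mapGt_dist x t0; move: (mapGt _ _ _ _) => y1.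
move: (mapG _ _ _ _) tq => y tq yy1.
apply: (@le_trans _ _ ((t * enorm (H y - H x)) ^+ 2)).
  apply: (@le_trans _ _ (t * (enorm (H y - H x) * enorm (y - y1)))).
    by rewrite ler_pM2l// dot_le.
  by rewrite mulrA expr2 ler_wpM2l// mulr_ge0 ?enorm_ge0// ltW.
apply: (@le_trans _ _ ((Num.sqrt (mu / 2) * enorm (x - y)) ^+ 2)).
  by rewrite ler_pXn2r// nnegrE mulr_ge0 ?enorm_ge0 ?sqrtr_ge0// ltW.
rewrite exprMn sqr_sqrtr ?divr_ge0 ?(ltW mu0)// ler_pM2l ?divr_gt0//.
by rewrite lerDl sqr_ge0.
Qed.

(** As x tends to xb and t to 0, x - t H(x) tends to xb, so G_t(x) tends to the projection of xb. *)
Lemma near_mapG xb (e : R) : 0 < e ->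
  exists2 t0 : R, 0 < t0 & \forall x \near xb, forall t, 0 < t <= t0 ->
    enorm (H (mapG Omega H t x) - H (proj Omega xb)) < e.
Proof.
move=> e0; set p := proj Omega xb.
have : \forall y \near p, enorm (H y - H p) < e.
  apply: (@near_lt _ _ (fun y => enorm (H y - H p))); last by rewrite subrr enorm0.
  apply: (@continuous_enorm_comp (fun y => H y - H p)) => y.
  by apply: continuousB; [exact: Hcont|exact: cst_continuous].
move=> /near_enorm[d d0 dP].
pose h := enorm (H xb) + 1.
have h0 : 0 < h by rewrite ltr_wpDl ?enorm_ge0.
exists (d / 2 / h); first by rewrite !divr_gt0.
have n1 : \forall x \near xb, enorm (x - xb) < d / 2.
  by apply/near_enorm; exists (d / 2) => //; rewrite divr_gt0.
have n2 : \forall x \near xb, enorm (H x) < h.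
  apply: (@near_lt _ _ (fun x => enorm (H x))); last by rewrite ltrDl.
  exact: continuous_enorm_comp.
near=> x => t /andP[t0]; rewrite ler_pdivlMr// => th; apply: dP.
apply: (le_lt_trans (proj_nonexpansive Oclosed Oconvex Oneq0 _ _)).
rewrite addrAC; apply: (le_lt_trans (enormD _ _)).
rewrite enormN enormZ gtr0_norm// [ltRHS]splitr ltr_leD//; first by near: x.
apply: le_trans th; rewrite ler_pM2l// ltW//; near: x; exact: n2.
Unshelve. all: by end_near. Qed.

Lemma near_ls_accept xb (mu gamma : R) : 0 < mu -> 0 < gamma -> ~ SOL Omega H xb ->
  exists2 t1 : R, 0 < t1 & \forall x \near xb, forall t, 0 < t <= t1 ->
    ls_accept Omega H mu x t.
Proof.
move=> mu0 g0 nS; set q := Num.sqrt (mu / 2).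
have q0 : 0 < q by rewrite sqrtr_gt0 divr_gt0.
have cH z : continuous (fun x => enorm (H x - H z)).
  apply: (@continuous_enorm_comp (fun y => H y - H z)) => y.
  by apply: continuousB; [exact: Hcont|exact: cst_continuous].
suff [t1 t10 t1P] : exists2 t1 : R, 0 < t1 &
    \forall x \near xb, forall t, 0 < t <= t1 ->
    t * enorm (H (mapG Omega H t x) - H x) <= q * enorm (x - mapG Omega H t x).
  exists t1 => //; apply: filterS t1P => x xP t tt1.
  by apply: ls_acceptS => //; [case/andP: tt1|exact: xP].
have [Ox|nOx] := pselect (Omega xb).
  (* Here xb is its own projection: H(G_t(x)) and H(x) are both within q c / 2 of H(xb), while the
     residual is at least c t. *)
  have [c c0 cP] := near_residual_ge g0 nS.
  have [|t0 t00 t0P] := @near_mapG xb (q * c / 2); first by rewrite !mulr_gt0.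
  exists (Num.min t0 gamma); first by rewrite lt_min t00.
  have n1 : \forall x \near xb, enorm (H x - H xb) < q * c / 2.
    apply: (@near_lt _ _ (fun x => enorm (H x - H xb))); first exact: cH.
    by rewrite subrr enorm0 !mulr_gt0.
  near=> x => t /andP[t_gt0]; rewrite le_min => /andP[tt0 tg].
  have H1 : enorm (H x - H xb) < q * c / 2 by near: x.
  have H2 : enorm (H (mapG Omega H t x) - H xb) < q * c / 2.
    rewrite -[in X in _ - H X](proj_id Oclosed Oconvex Oneq0 Ox).
    move: (t) t_gt0 tt0 {tg} => {}t t_gt0 tt0.
    have : forall t, 0 < t <= t0 ->
      enorm (H (mapG Omega H t x) - H (proj Omega xb)) < q * c / 2 by near: x.
    by apply; rewrite t_gt0.
  have H3 : c * t <= enorm (x - mapG Omega H t x).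
    move: (t) t_gt0 tg {tt0 H2} => {}t t_gt0 tg.
    have : forall t, 0 < t <= gamma ->
       c * t <= enorm (x - mapG Omega H t x) by near: x.
    by apply; rewrite t_gt0.
  rewrite -(ler_pM2l q0) in H3; apply: le_trans H3.
  rewrite mulrA [leRHS]mulrC ler_pM2l//.
  have := enorm_triangle (H xb) (H (mapG Omega H t x)) (H x).
  by rewrite (enormB (H xb) (H x)); lra.
(* Outside Omega, H(G_t(x)) - H(x) need not be small, but it stays below D and the residual is at
   least c, so t <= q c / D suffices. *)
have [c c0 cP] := near_dist nOx.
have [|t0 t00 t0P] := @near_mapG xb 1; first by [].
set p := proj Omega xb in t0P.
pose D := enorm (H xb - H p) + 2.
have D0 : 0 < D by rewrite ltr_wpDl ?enorm_ge0.
exists (Num.min t0 (q * c / D)); first by rewrite lt_min t00 divr_gt0// mulr_gt0.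
have n1 : \forall x \near xb, enorm (H x - H p) < D - 1.
  apply: (@near_lt _ _ (fun x => enorm (H x - H p))); first exact: cH.
  by rewrite /D; lra.
near=> x => t /andP[t_gt0]; rewrite le_min ler_pdivlMr// => /andP[tt0 tg].
have H1 : enorm (H x - H p) < D - 1 by near: x.
have H2 : enorm (H (mapG Omega H t x) - H p) < 1.
  move: (t) t_gt0 tt0 {tg} => {}t t_gt0 tt0.
  have : forall t, 0 < t <= t0 ->
    enorm (H (mapG Omega H t x) - H p) < 1 by near: x.
  by apply; rewrite t_gt0.
apply: (@le_trans _ _ (q * c)); last first.
  rewrite ler_pM2l//.
  have : forall z, Omega z -> c <= enorm (x - z) by near: x.
  by apply; exact: Pin.
apply: le_trans tg; rewrite ler_pM2l//.
have := enorm_triangle (H p) (H (mapG Omega H t x)) (H x).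
by rewrite (enormB (H p) (H x)); lra.
Unshelve. all: by end_near. Qed.

(** For the lower bound, either the first trial gamma is accepted, or the preceding trial t / rho
    was rejected and so exceeds [t1]. *)
Lemma ls_stepP (mu gamma rho : R) x : 0 < mu -> 0 < gamma -> 0 < rho < 1 ->
  ~ SOL Omega H x ->
  let t := ls_step Omega H gamma rho mu x in
  [/\ 0 < t <= gamma, ls_accept Omega H mu x t &
    forall t1, 0 < t1 -> (forall s, 0 < s <= t1 -> ls_accept Omega H mu x s) ->
      Num.min gamma (rho * t1) <= t].
Proof.
move=> mu0 g0 /andP[rho0 rho1] nS; rewrite /= /ls_step.
have grho k : 0 < gamma * rho ^+ k by rewrite mulr_gt0// exprn_gt0.
case: xgetP => [m _ /= [am mmin]|nex]; last first.
  (* The default of [xget] cannot occur: rho^k tends to 0, so some trial falls below [t1] and is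
     accepted, and a least accepted exponent exists. *)
  have [t1 t10 /nbhs_singleton t1P] := near_ls_accept mu0 g0 nS.
  have exm : exists m, ls_accept Omega H mu x (gamma * rho ^+ m).
    have : rho ^+ k @[k --> \oo] --> 0 by apply: cvg_expr; rewrite gtr0_norm.
    move=> /cvgrPdist_lt/(_ (t1 / gamma)) []; first by rewrite divr_gt0.
    move=> m _ /(_ m (leqnn m)) /=.
    rewrite sub0r normrN gtr0_norm ?exprn_gt0// ltr_pdivlMr// mulrC => mt.
    by exists m; apply: t1P; rewrite grho ltW.
  case: (ex_minnP exm) => m am mmin; case: (nex m); split => //= j jm.
  by apply: contraL jm => aj; rewrite -leqNgt mmin.
split=> //.
  by rewrite grho ger_pMr// exprn_ile1 ?ltW.
move=> t1 t10 t1P; rewrite ge_min.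
case: m am mmin => [|m] am mmin; first by rewrite expr0 mulr1 lexx.
apply/orP; right; rewrite exprS mulrCA ler_pM2l//.
have /negP := mmin m (ltnSn m); apply: contra_notT; rewrite -ltNge => /ltW lt1.
by apply: t1P; rewrite grho.
Qed.

(* Korpelevich's inequality: only points of [Omega] enter through the
   projections, so [x] itself may lie outside [Omega], as extrapolated
   iterates do. *)
Lemma extragradient_fejer (mu t : R) x xs : pseudomonotone Omega H ->
  0 < t -> SOL Omega H xs -> ls_accept Omega H mu x t ->
  let y := mapG Omega H t x in let y1 := mapGt Omega H t x in
  enorm (y1 - xs) ^+ 2 + (1 - mu) * (enorm (x - y) ^+ 2 + enorm (y - y1) ^+ 2)
    <= enorm (x - xs) ^+ 2.
Proof.
move=> Hmono t0 [Oxs xsP]; rewrite /ls_accept.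
(* The claim is twice the sum of four inequalities: the obtuse angle at y1 tested with xs, the one
   at y tested with y1, t times pseudomonotonicity at y, and the line-search test. *)
have := P (x - t *: H (mapG Omega H t x)) Oxs; rewrite -/(mapGt Omega H t x).
have := P (x - t *: H x) (Pin (x - t *: H (mapG Omega H t x))).
rewrite -/(mapGt Omega H t x) -/(mapG Omega H t x).
have : 0 <= dot (H (mapG Omega H t x)) (mapG Omega H t x - xs).
  by apply: Hmono => //; [exact: Pin|apply: xsP; exact: Pin].
move: (mapG _ _ _ _) (mapGt _ _ _ _) => y y1.
rewrite -(pmulr_rge0 _ t0) !sqr_enorm !dotE.
rewrite ?(dotC xs) ?(dotC y1) ?(dotC y x) ?(dotC _ (H x)) ?(dotC _ (H y)).
rewrite ?mulrDr ?mulrN.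
lra.
Qed.

End Extragradient.

(** * Quasi-Fejer sequences *)

Lemma cluster_seq (T : topologicalType) (x : nat -> T) (xb : T)
    (P : set nat) (Q : set T) :
  cluster (x @ \oo) xb -> (\forall k \near \oo, P k) ->
  (\forall z \near xb, Q z) -> exists k, P k /\ Q (x k).
Proof.
move=> xc nP nQ.
have [|_ [[k Pk <-] Qk]] := xc (x @` P) Q _ nQ; last by exists k.
by apply: filterS nP => k Pk; exists k.
Qed.

(** The errors enter as increments of a bounded monotone s instead of a summable series: a - s is
    nonincreasing and bounded below, and b is at most its decrement. *)
Lemma quasi_fejer (R : realType) (a b s : nat -> R) (B : R) :
  (forall k, 0 <= a k) -> (forall k, 0 <= b k) ->
  (forall k, s k <= s k.+1) -> (forall k, s k <= B) ->
  (forall k, a k.+1 + b k <= a k + (s k.+1 - s k)) ->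
  cvgn a /\ b @ \oo --> 0.
Proof.
move=> a0 b0 sS sB abs; pose V k := a k - s k.
have VS k : V k.+1 + b k <= V k by rewrite /V; have := abs k; lra.
have cV : cvgn V.
  apply: nonincreasing_is_cvgn.
    by apply/nonincreasing_seqP => k; have := VS k; have := b0 k; lra.
  by exists (- B) => _ [k _ <-]; rewrite /V; have := a0 k; have := sB k; lra.
have cs : cvgn s.
  apply: nondecreasing_is_cvgn; first exact/nondecreasing_seqP.
  by exists B => _ [k _ <-].
split.
  have -> : a = V \+ s by apply/funext => k; rewrite /= subrK.
  exact: is_cvgD.
apply: (@squeeze_cvgr _ _ _ _ (fun=> 0) (fun k => V k - V k.+1)).
- by apply: nearW => k; rewrite b0/=; have := VS k; lra.
- exact: cvg_cst.
- rewrite -(subrr (limn V)); apply: cvgB => //.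
  by rewrite (cvg_shiftS V).
Qed.

(* The terms of the convergent series sum of x^(-1-q) are dominated by a
   telescoping difference: 1/y <= ln y - ln x for y = x + 1, and
   exp u >= 1 + u. *)
Lemma powR_telescope (R : realType) (q x : R) : 0 < q -> 1 <= x ->
  x `^ (- (q + 1)) <=
    2 `^ (q + 1) / q * (x `^ (- q) - (x + 1) `^ (- q)).
Proof.
move=> q0 x1; have x0 : 0 < x by lra.
have y0 : 0 < x + 1 by lra.
have powE (z r : R) : 0 < z -> z `^ r = expR (r * ln z).
  by move=> z0; rewrite /powR gt_eqF.
have lnE : (x + 1)^-1 <= ln (x + 1) - ln x.
  have : ln (1 + - (x + 1)^-1) <= - (x + 1)^-1.
    by apply: le_ln1Dx; rewrite ltrN2 invf_lt1//; lra.
  have -> : 1 + - (x + 1)^-1 = x / (x + 1) by field; lra.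
  by rewrite ln_div ?posrE//; lra.
have H1 : q * (x + 1) `^ (- (q + 1)) <= x `^ (- q) - (x + 1) `^ (- q).
  have -> : (x + 1) `^ (- (q + 1)) = (x + 1) `^ (- q) * (x + 1)^-1.
    rewrite opprD powRD; last by rewrite (gt_eqF y0) implybT.
    by rewrite powR_inv1// ltW.
  have -> : x `^ (- q) = (x + 1) `^ (- q) * expR (q * (ln (x + 1) - ln x)).
    by rewrite !powE// -expRD; congr expR; ring.
  have -> : forall c e : R, c * e - c = c * (e - 1) by move=> *; ring.
  rewrite mulrCA ler_pM2l ?powR_gt0// lerBrDl.
  apply: le_trans (expR_ge1Dx _); rewrite lerD2l ler_pM2l//.
(* Uses x + 1 <= 2 x, valid since x >= 1. *)
have H2 : x `^ (- (q + 1)) <= 2 `^ (q + 1) * (x + 1) `^ (- (q + 1)).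
  rewrite !powRN ler_pdivlMr ?powR_gt0// mulrC ler_pdivrMr ?powR_gt0//.
  rewrite -powRM; [|lra|lra].
  by apply: ge0_ler_powR; rewrite ?nnegrE; lra.
apply: le_trans H2 _; rewrite -mulrA ler_pM2l ?powR_gt0//.
by rewrite mulrC ler_pdivlMr// mulrC.
Qed.

(** * Anderson steps *)

Section Step.
Context (R : realType) (n : nat) (Omega : set 'rV[R]_n) (H : 'rV[R]_n -> 'rV[R]_n).
Context (omega gamma tau rho mu M : R).
Context (Oclosed : closed Omega)
  (Oconvex : convex_set (Omega : set (convex_lmodType 'rV[R]_n)))
  (Hcont : continuous H) (Hmono : pseudomonotone Omega H)
  (omega_ge0 : 0 <= omega) (gamma_gt0 : 0 < gamma) (tau_gt : 1 / 2 < tau)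
  (rho01 : 0 < rho < 1) (mu01 : 0 < mu < 1) (M_gt0 : 0 < M).
Implicit Types (x xs : 'rV[R]_n) (sigma : nat).

(** The value M + 1 fails the test. Otherwise |F|^2 = |Ft|^2 - 2 <Ft, Ft - F> + |Ft - F|^2, so |Ft|
    < |F| puts the quotient below 1/2. *)
Lemma ega_alpha_le x sigma :
  let Ft := mapFt Omega H (ls_step Omega H gamma rho mu x) x in
  let a := ega_alpha Omega H omega gamma tau rho mu M x sigma in
  `|a| <= M -> a <= 1 / 2 /\ enorm Ft <= omega * sigma%:R `^ (- tau).
Proof.
rewrite /= /ega_alpha; case: ifPn => [|_]; last first.
  by move=> /(le_trans (ler_norm _)); lra.
rewrite lt_min => /andP[FtF Fts] _; split; last exact: ltW.
move: FtF {Fts}; move: (mapF _ _ _ _) (mapFt _ _ _ _) => F Ft FtF.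
rewrite -(@ltr_pXn2r _ 2)// ?nnegrE ?enorm_ge0// !sqr_enorm in FtF.
have FF : 0 < dot (Ft - F) (Ft - F).
  rewrite lt_neqAle dot_ge0 andbT eq_sym -sqr_enorm sqrf_eq0.
  apply: contraTN FtF => /eqP/enorm_eq0/eqP; rewrite subr_eq0 => /eqP ->.
  by rewrite ltxx.
rewrite sqr_enorm ler_pdivrMr//; move: FtF.
by rewrite !dotE (dotC F Ft); lra.
Qed.

(** A multiple of -sigma^(-q), q = 2 tau - 1, with the constant of [powR_telescope], so that its
    increments dominate the Anderson errors. It depends on sigma, not k, since only Anderson steps
    incur errors. *)
Definition fejer_pot sigma : R :=
  - (M * (1 + M) * omega ^+ 2 * (2 `^ (2 * tau) / (2 * tau - 1))
     * sigma%:R `^ (- (2 * tau - 1))).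

Lemma fejer_pot_const_ge0 :
  0 <= M * (1 + M) * omega ^+ 2 * (2 `^ (2 * tau) / (2 * tau - 1)).
Proof.
have M1 : 0 < 1 + M by move: M_gt0; lra.
have q0 : 0 < 2 * tau - 1 by move: tau_gt; lra.
by rewrite !mulr_ge0 ?(ltW M_gt0) ?(ltW M1) ?sqr_ge0 ?powR_ge0 ?invr_ge0 ?(ltW q0).
Qed.

Lemma fejer_pot_le0 sigma : fejer_pot sigma <= 0.
Proof. by rewrite oppr_le0 mulr_ge0 ?fejer_pot_const_ge0 ?powR_ge0. Qed.

Lemma fejer_potS sigma : (0 < sigma)%N ->
  M * (1 + M) * (omega * sigma%:R `^ (- tau)) ^+ 2
    <= fejer_pot sigma.+1 - fejer_pot sigma.
Proof.
move=> s0; have s1 : 1 <= sigma%:R :> R by rewrite ler1n.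
have q0 : 0 < 2 * tau - 1 by move: tau_gt; lra.
have := powR_telescope q0 s1; rewrite subrK => tel.
have -> : (omega * sigma%:R `^ (- tau)) ^+ 2
    = omega ^+ 2 * sigma%:R `^ (- (2 * tau)).
  rewrite exprMn -[X in _ * X]powR_mulrn ?powR_ge0// -powRrM.
  by congr (_ * _ `^ _); ring.
have C0 : 0 <= M * (1 + M) * omega ^+ 2.
  by rewrite !mulr_ge0 ?sqr_ge0//; move: M_gt0; lra.
rewrite mulrA; apply: le_trans (ler_wpM2l C0 tel) _.
by rewrite /fejer_pot -[sigma.+1%:R]natr1 opprK; lra.
Qed.

Lemma fejer_pot_homo sigma : (0 < sigma)%N -> fejer_pot sigma <= fejer_pot sigma.+1.
Proof.
move=> /fejer_potS; rewrite -(subr_ge0 (fejer_pot sigma)); apply: le_trans.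
by rewrite !mulr_ge0 ?sqr_ge0//; move: M_gt0; lra.
Qed.

Definition step_residual x : R :=
  enorm (x - mapG Omega H (ls_step Omega H gamma rho mu x) x) ^+ 2.

(* Since [a <= 1 / 2], the averaging identity
   |a u + (1 - a) v|^2 = a |u|^2 + (1 - a) |v|^2 - a (1 - a) |u - v|^2
   keeps at least half of the decrease achieved by the extragradient step. *)
Lemma ega_step_fejer x xs sigma : ~ SOL Omega H x -> SOL Omega H xs ->
  (0 < sigma)%N ->
  let s := ega_step Omega H omega gamma tau rho mu M (x, sigma) in
  [/\ (0 < s.2)%N, fejer_pot sigma <= fejer_pot s.2 &
  enorm (s.1 - xs) ^+ 2 + (1 - mu) / 2 * step_residual x
    <= enorm (x - xs) ^+ 2 + (fejer_pot s.2 - fejer_pot sigma)].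
Proof.
move=> nS xsS s0; have [mu0 mu1] := andP mu01.
have Oneq0 : Omega !=set0 by case: xsS => ? _; exists xs.
have [/andP[t0 _] acc _] :=
  ls_stepP Oclosed Oconvex Hcont Oneq0 mu0 gamma_gt0 rho01 nS.
have := extragradient_fejer Oclosed Oconvex Oneq0 Hmono t0 xsS acc.
have := @ega_alpha_le x sigma; rewrite /= /step_residual /mapFt.
move: (mapG _ _ _ _) (mapGt _ _ _ _) (ega_alpha _ _ _ _ _ _ _ _ _ _) => y y1 a.
move=> + fej; set b := enorm (x - y) in fej *; set c := enorm (y - y1) in fej.
have b0 : 0 <= (1 - mu) * b ^+ 2 by rewrite mulr_ge0 ?sqr_ge0//; lra.
have c0 : 0 <= (1 - mu) * c ^+ 2 by rewrite mulr_ge0 ?sqr_ge0//; lra.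
case: ifPn => [aM /(_ isT)[a12 Fts]|_ _] /=; last by split=> //; lra.
split => //; first exact: fejer_pot_homo.
have pot := fejer_potS s0.
have -> : a *: x + (1 - a) *: y1 - xs = a *: (x - xs) + (1 - a) *: (y1 - xs).
  by rewrite !scalerBr addrACA -opprD -scalerDl subrKC scale1r.
have Fts2 : enorm (y1 - x) ^+ 2 <= (omega * sigma%:R `^ (- tau)) ^+ 2.
  by rewrite ler_pXn2r// nnegrE ?enorm_ge0// mulr_ge0 ?powR_ge0.
have avg : enorm (a *: (x - xs) + (1 - a) *: (y1 - xs)) ^+ 2 =
    a * enorm (x - xs) ^+ 2 + (1 - a) * enorm (y1 - xs) ^+ 2
    - a * (1 - a) * enorm (y1 - x) ^+ 2.
  have -> : y1 - x = (y1 - xs) - (x - xs) by rewrite opprB subrKA.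
  move: (y1 - xs) (x - xs) => v u; rewrite !sqr_enorm !dotE (dotC v u); ring.
(* Since |a| <= M, -a (1 - a) = a^2 - a <= M (1 + M). *)
have err : - (a * (1 - a) * enorm (y1 - x) ^+ 2)
    <= M * (1 + M) * (omega * sigma%:R `^ (- tau)) ^+ 2.
  apply: (@le_trans _ _ (M * (1 + M) * enorm (y1 - x) ^+ 2)); last first.
    by apply: ler_wpM2l => //; rewrite mulr_ge0//; move: M_gt0; lra.
  rewrite -mulNr ler_wpM2r ?sqr_ge0//.
  by move: aM; rewrite ler_norml => /andP[]; move: M_gt0; nra.
rewrite avg.
move: fej pot err; set A := enorm (x - xs) ^+ 2; set V := enorm (y1 - xs) ^+ 2.
move=> fej pot err.
have : 1 / 2 * (A - V) <= (1 - a) * (A - V) by rewrite ler_wpM2r//; lra.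
lra.
Qed.

End Step.

(** * Convergence of the iterates *)

Theorem theorem3p5 (R : realType) (n : nat)
    (Omega : set 'rV[R]_n) (H : 'rV[R]_n -> 'rV[R]_n)
    (omega gamma tau rho mu M : R) (x0 : 'rV[R]_n) :
  closed Omega ->
  convex_set (Omega : set (convex_lmodType 'rV[R]_n)) ->
  continuous H ->
  pseudomonotone Omega H ->
  SOL Omega H !=set0 ->
  0 <= omega -> 0 < gamma -> 1 / 2 < tau ->
  0 < rho < 1 -> 0 < mu < 1 -> 0 < M ->
  Omega x0 ->
  let x := ega_seq Omega H omega gamma tau rho mu M x0 in
  (forall k, mapF Omega H gamma (x k) != 0) ->
  exists2 xs, SOL Omega H xs & x @ \oo --> xs.
Proof.
move=> Oclosed Oconvex Hcont Hmono [xs xsS] omega0 gamma0 tau12 rho01 mu01 M0 _.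
move=> x nstop.
have Oneq0 : Omega !=set0 by case: xsS => ? _; exists xs.
have [mu0 mu1] := andP mu01.
have nS k : ~ SOL Omega H (x k).
  by move=> /(mapF_SOL Oclosed Oconvex Oneq0 gamma0)/eqP; exact/negP.
pose st k := iter k (ega_step Omega H omega gamma tau rho mu M) (x0, 1%N).
pose sigma k := (st k).2.
pose pot := fejer_pot omega tau M.
pose res k := step_residual Omega H gamma rho mu (x k).
have stS k : st k.+1 = ega_step Omega H omega gamma tau rho mu M (x k, sigma k).
  by rewrite /x /ega_seq /sigma /st iterS -surjective_pairing.
have step z k : SOL Omega H z -> (0 < sigma k)%N ->
  [/\ (0 < sigma k.+1)%N, pot (sigma k) <= pot (sigma k.+1) &
  enorm (x k.+1 - z) ^+ 2 + (1 - mu) / 2 * res k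
    <= enorm (x k - z) ^+ 2 + (pot (sigma k.+1) - pot (sigma k))].
  move=> zS sk.
  have := ega_step_fejer Oclosed Oconvex Hcont Hmono omega0 gamma0 tau12 rho01
    mu01 M0 (nS k) zS sk.
  by rewrite -stS.
have sigma_gt0 k : (0 < sigma k)%N by elim: k => // k /(step _ k xsS)[].
(* Needed for two solutions: [xs], to bound the iterates, and later the cluster point [xb]. *)
have fejer z : SOL Omega H z ->
    cvgn (fun k => enorm (x k - z) ^+ 2) /\
    (fun k => (1 - mu) / 2 * res k) @ \oo --> 0.
  move=> zS; apply: (@quasi_fejer _ _ _ (pot \o sigma) 0) => k.
  - exact: sqr_ge0.
  - by rewrite mulr_ge0 ?sqr_ge0//; lra.
  - by have [] := step z k zS (sigma_gt0 k).
  - exact: fejer_pot_le0.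
  - by have [] := step z k zS (sigma_gt0 k).
have [cxs cres] := fejer xs xsS.
have res_small e : 0 < e -> \forall k \near \oo, res k < e.
  move=> e0; have c0 : 0 < (1 - mu) / 2 by lra.
  have ce : 0 < (1 - mu) / 2 * e by rewrite mulr_gt0.
  by apply: filterS (cvgr_lt _ cres _ ce) => k; rewrite ltr_pM2l.
have [xb [_ xbc]] : [set z | enorm (xs - z) <=
    Num.sqrt (limn (fun k => enorm (x k - xs) ^+ 2) + 1)] `&` cluster (x @ \oo) !=set0.
  apply: compact_enorm_ball.
  have [|N _ NP] := cvgr_lt _ cxs (limn (fun k => enorm (x k - xs) ^+ 2) + 1).
    by rewrite ltrDl.
  exists N => // k /NP /= /ltW; rewrite sqr_enorm enormB.
  exact: ler_wsqrtr.
have xbS : SOL Omega H xb.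
  apply: contrapT => nxb.
  have [c c0 cP] := near_residual_ge Oclosed Oconvex Hcont Oneq0 gamma0 nxb.
  have [t1 t10 t1P] := near_ls_accept Oclosed Oconvex Hcont Oneq0 mu0 gamma0 nxb.
  (* Near [xb] the accepted steps are at least m, so the squared residual is at least (c m)^2,
     although it tends to 0. *)
  pose m := Num.min gamma (rho * t1).
  have m0 : 0 < m by rewrite lt_min gamma0 mulr_gt0//; case/andP: rho01.
  have /res_small small : 0 < (c * m) ^+ 2 by rewrite exprn_gt0// mulr_gt0.
  have [k [rk [/= ck ak]]] := cluster_seq xbc small (filterI cP t1P).
  have [tk _ /(_ t1 t10 ak) mt] :=
    ls_stepP Oclosed Oconvex Hcont Oneq0 mu0 gamma0 rho01 (nS k).
  move: rk; rewrite ltNge => /negP; apply.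
  rewrite ler_pXn2r ?nnegrE ?enorm_ge0 ?mulr_ge0 ?(ltW c0) ?(ltW m0)//.
  by apply: le_trans (ck _ tk); rewrite ler_pM2l.
exists xb => //; have [cxb _] := fejer xb xbS.
(* The limit exists by [fejer]; if it exceeded some e > 0, no late iterate could come within sqrt(e)
   of the cluster point [xb]. *)
have lim0 : limn (fun k => enorm (x k - xb) ^+ 2) <= 0.
  apply/ler_addgt0Pr => e e0; rewrite add0r leNgt; apply/negP => eL.
  have nd : \forall z \near xb, enorm (z - xb) < Num.sqrt e.
    by apply/near_enorm; exists (Num.sqrt e) => //; rewrite sqrtr_gt0.
  have [k [/= ek]] := cluster_seq xbc (cvgr_gt _ cxb _ eL) nd.
  rewrite sqr_enorm in ek.
  by rewrite /enorm ltr_sqrt// => /(lt_trans ek); rewrite ltxx.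
move=> A /near_enorm[d d0 dA].
have : \forall k \near \oo, enorm (x k - xb) ^+ 2 < d ^+ 2.
  by apply: (cvgr_lt _ cxb); apply: (le_lt_trans lim0); rewrite exprn_gt0.
apply: filterS => k; rewrite ltr_pXn2r ?nnegrE ?enorm_ge0 ?ltW// => xd.
exact: dA.
Qed.
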